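(* For any irreducible right-angled Coxeter group $\Gamma$ on $k$ generators, there exist $p,q\in\mathbb{N}$ with $p+q+1=k$ and a smooth path $(\rho_t)_{t\in I}$ in $\mathrm{Hom}(\Gamma,G)$ of faithful and discrete representations into $G:=\mathrm{O}(p,q+1)$, where $I\neq\varnothing$ is an open interval, such that for any $t\in I$, the affine action of $\Gamma$ on the Lie algebra $\mathfrak{g}=\mathfrak{o}(p,q+1)\simeq\mathbb{R}^{k(k-1)/2}$ via $(\rho_t,u_t)$ is properly discontinuous, where $u_t:\Gamma\to\mathfrak{g}$ is the $\rho_t$-cocycle $$u_t(\gamma)=\frac{\mathrm{d}}{\mathrm{d}s}\Big|_{s=t}\,\rho_s(\gamma)\rho_t(\gamma)^{-1}.$$
   Context: A right-angled Coxeter group on $k$ generators is a group $\Gamma=\Gamma_S$ with a presentation $\langle \gamma_1,\dots,\gamma_k \mid (\gamma_i\gamma_j)^{m_{i,j}}=1\ \forall i,j\rangle$, where $m_{i,i}=1$ and $m_{i,j}=m_{j,i}\in\{2,\infty\}$ for $i\neq j$ (no relation when $m_{i,j}=\infty$), $S=\{\gamma_1,\dots,\gamma_k\}$. It is irreducible if $S$ cannot be written as a disjoint union $S=S'\sqcup S''$ of two nonempty subsets such that the subgroups generated by $S'$ and $S''$ commute. $\mathbb{N}$ contains $0$. $\mathrm{O}(p,q+1)$ is the group of linear automorphisms of $\mathbb{R}^{p+q+1}$ preserving a symmetric bilinear form of signature $(p,q+1)$. A representation is faithful and discrete if it is injective with discrete image. A path $(\rho_t)$ in $\mathrm{Hom}(\Gamma,G)$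 is smooth if $t\mapsto\rho_t(\gamma)$ is smooth for every $\gamma\in\Gamma$. For a Lie group $G$ with Lie algebra $\mathfrak{g}$ and a homomorphism $\rho:\Gamma\to G$, a $\rho$-cocycle is a map $u:\Gamma\to\mathfrak{g}$ with $u(\gamma_1\gamma_2)=u(\gamma_1)+\mathrm{Ad}(\rho(\gamma_1))u(\gamma_2)$ for all $\gamma_1,\gamma_2$. The affine action of $\Gamma$ on $\mathfrak{g}$ via $(\rho,u)$ is $\gamma\bullet v=\mathrm{Ad}(\rho(\gamma))v+u(\gamma)$. An action of a discrete group is properly discontinuous if for every compact set $\mathscr{C}$, only finitely many $\gamma$ satisfy $\gamma\cdot\mathscr{C}\cap\mathscr{C}\neq\varnothing$. *)

(* Defs.v *)
From HB Require Import structures.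
From mathcomp Require Import all_boot all_order all_algebra.
From mathcomp Require Import all_classical all_reals all_analysis.

Set Implicit Arguments.
Unset Strict Implicit.
Unset Printing Implicit Defensive.

Import Order.TTheory GRing.Theory Num.Theory.
Import numFieldNormedType.Exports.

Local Open Scope classical_set_scope.
Local Open Scope ring_scope.

(* The letter (i, false) stands for the i-th generator and (i, true) for its
   formal inverse. *)
Definition word (T : Type) := seq (T * bool).

Definition eval_word (T : Type) (G : groupType) (g : T -> G) (w : word T) : G :=
  (\prod_(l <- w) (if l.2 then (g l.1)^-1 else g l.1))%g.

(* Equality of words in the group < T | rels >, that is, in the quotient of the
   free group on T by the normal closure of rels. *)
Inductive word_equiv (T : Type) (rels : set (word T)) :
    word T -> word T -> Prop :=
| word_equiv_refl w : word_equiv rels w w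
| word_equiv_sym v w : word_equiv rels v w -> word_equiv rels w v
| word_equiv_trans u v w :
    word_equiv rels u v -> word_equiv rels v w -> word_equiv rels u w
| word_equiv_cancel u v i b :
    word_equiv rels (u ++ [:: (i, b); (i, ~~ b)] ++ v) (u ++ v)
| word_equiv_rel u v r : rels r -> word_equiv rels (u ++ r ++ v) (u ++ v).

Definition has_presentation (T : Type) (G : groupType) (g : T -> G)
    (rels : set (word T)) : Prop :=
  (forall x : G, exists w, eval_word g w = x) /\
  (forall v w, eval_word g v = eval_word g w <-> word_equiv rels v w).

(* Coxeter exponents live in option nat, with None standing for infinity. *)
Definition right_angled_exponents k (m : 'I_k -> 'I_k -> option nat) : Prop :=
  [/\ forall i, m i i = Some 1%N,
      forall i j, m i j = m j i &
      forall i j, i != j -> m i j = Some 2%N \/ m i j = None].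

Definition coxeter_relators k (m : 'I_k -> 'I_k -> option nat) :
    set (word 'I_k) :=
  [set w | exists i j n, m i j = Some n /\
    w = flatten (nseq n [:: (i, false); (j, false)])].

Definition right_angled_coxeter k (G : groupType) (g : 'I_k -> G) : Prop :=
  exists m, right_angled_exponents m /\ has_presentation g (coxeter_relators m).

Definition generated_subgroup (G : groupType) (A : set G) : set G :=
  smallest (fun H : set G => group_closed [in H]) A.

Definition coxeter_irreducible (G : groupType) (S : set G) : Prop :=
  ~ exists S1 S2 : set G,
      [/\ S1 !=set0, S2 !=set0, S1 `&` S2 = set0, S1 `|` S2 = S &
          forall x y, generated_subgroup S1 x -> generated_subgroup S2 y ->
            commute x y].

Section IndefiniteOrthogonal.
Variables (R : realType) (p q : nat).
Local Notation mat := 'M[R]_((p + q).+1).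

(* p entries 1 followed by q + 1 entries -1. *)
Definition form_mx : mat :=
  diag_mx (\row_(i < (p + q).+1) (if (i < p)%N then 1 else -1)).

Definition indefinite_orthogonal : set mat :=
  [set A : mat | A^T *m form_mx *m A = form_mx].

Definition indefinite_orthogonal_lie : set mat :=
  [set X : mat | X^T *m form_mx + form_mx *m X = 0].

Definition Ad (A X : mat) : mat := A *m X *m invmx A.

Variable G : groupType.

Definition orthogonal_representation (rho : G -> mat) : Prop :=
  (forall x, indefinite_orthogonal (rho x)) /\
  (forall x y, rho (x * y)%g = rho x *m rho y).

Definition cocycle (rho u : G -> mat) : Prop :=
  (forall x, indefinite_orthogonal_lie (u x)) /\
  (forall x y, u (x * y)%g = u x + Ad (rho x) (u y)).

Definition affine_action (rho u : G -> mat) (x : G) (v : mat) : mat :=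
  Ad (rho x) v + u x.

Definition tangent_cocycle (rho : R -> G -> mat) (t : R) (x : G) : mat :=
  derive1 (fun s => rho s x *m invmx (rho t x)) t.

End IndefiniteOrthogonal.

Definition discrete_subset (T : topologicalType) (A : set T) : Prop :=
  A `<=` isolated A.

(* On an open set I the iterated derivatives at points of I only depend on the
   restriction of f to I. *)
Definition smooth_on (R : realType) (V : normedModType R) (I : set R)
    (f : R -> V) : Prop :=
  forall n t, I t -> derivable (derive1n n f) t 1.

(* Proper discontinuity of an action preserving the subset X, with its subspace
   topology. *)
Definition properly_discontinuous_on (G : Type) (T : topologicalType)
    (X : set T) (act : G -> T -> T) : Prop :=
  forall C : set T, C `<=` X -> compact C ->
    finite_set [set x : G | (act x @` C) `&` C !=set0].

(* Main.v *)
Require Import Defs.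
From HB Require Import structures.
From mathcomp Require Import all_boot all_order all_algebra.
From mathcomp Require Import all_classical all_reals all_analysis.
From mathcomp Require Import ring lra.
From mathcomp Require Import perm polyrcf.

(** Call two generators far when their product has infinite order. For a
    parameter t > 0, give R^k the quadratic form in which the basis vectors e_i
    have norm 1, far pairs have product -(1 + t), and the other pairs are
    orthogonal. The generators act by the orthogonal reflections in the e_i, and
    this is the geometric representation, deformed by pushing the far walls
    apart as t grows.

    Let x be the vector that pairs to -1 with every e_i. Applying gamma moves it
    to x + c(gamma), where the coordinates of c(gamma) are polynomials in t.
    Along a geodesic word, each new letter increases one coordinate and keeps
    all coefficients nonnegative ([deviation], [balanced_step]); that every
    element has such a word is the exchange condition [deviation_exchange].
    So the sum f(t) of the coordinates of c(gamma), its [height], has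
    nonnegative coefficients and is at least twice the length of gamma. Since
    <x, gamma x> = f + <x, x> for the opposite form, f measures the displacement
    of x; faithfulness and discreteness follow at once.

    For the affine action, suppose that gamma . v = w with v and w in a fixed
    compact set. Differentiating <x_s, rho_s(gamma) x_s> and eliminating
    u(gamma) = w - Ad(rho(gamma)) v bounds the result by the sizes of gamma x
    and of gamma^-1 x ([derive_pairing_bound]), so f'(t) <= K (1 + f(t)) with K
    independent of gamma. For a polynomial with nonnegative coefficients
    this forces most of f(t) to come from low degrees, so f(t) is at most a
    constant multiple of f(1), plus a constant ([horner_le_deriv]). On the other
    hand, for t large, comparing the recursions at 1 and at t gives
    f(1)^2 <= 4 k f(t) ([height_growth]). Hence f(1), and with it the length of
    gamma, is bounded, and only finitely many gamma remain.

    The form has to be made independent of t. The Gram matrix is polynomial in t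
    and is the identity at t = -1, so fraction-free elimination makes it
    congruent to a diagonal matrix with nonzero polynomial entries
    ([unit_congruence]). Their signs are constant for t large, and dividing by
    square roots gives a smooth path of frames in which the opposite of the form
    is standard. The opposite form is negative on e_1, so its signature is
    (p, q + 1) with p + q + 1 = k. *)

Set Implicit Arguments.
Unset Strict Implicit.
Unset Printing Implicit Defensive.

Import Order.TTheory GRing.Theory Num.Theory.
Import numFieldNormedType.Exports.

Local Open Scope classical_set_scope.
Local Open Scope ring_scope.

(** * Right-angled Coxeter groups acting by reflections *)

(** The target is only a ring: since the images of the generators are
    involutions, a formal inverse can have the same image as its letter. *)
Lemma presentation_lift (T : Type) (G : groupType) (g : T -> G)
    (rels : set (word T)) (A : pzRingType) (h : T -> A) :
    has_presentation g rels -> (forall i, h i * h i = 1) ->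
    (forall r, rels r -> \prod_(l <- r) h l.1 = 1) ->
  exists phi : G -> A,
    [/\ phi 1%g = 1, forall x y, phi (x * y)%g = phi x * phi y &
        forall i, phi (g i) = h i].
Proof.
move=> [surj eqv] hh hrel.
pose ev (w : word T) := \prod_(l <- w) h l.1.
have ev_equiv v w : word_equiv rels v w -> ev v = ev w.
  elim=> {v w} // [u v w _ -> _ -> //|u v i b|u v r /hrel r1].
    by rewrite /ev !big_cat !big_cons big_nil /= mulr1 hh mul1r.
  by rewrite /ev !big_cat /= r1 mul1r.
pose w x := projT1 (cid (surj x)).
have wK x : eval_word g (w x) = x by exact: projT2 (cid (surj x)).
have phiE v : ev (w (eval_word g v)) = ev v.
  by apply: ev_equiv; apply/eqv; rewrite wK.
exists (fun x => ev (w x)); split.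
- have -> : 1%g = eval_word g [::] by rewrite /eval_word big_nil.
  by rewrite phiE /ev big_nil.
- move=> x y; rewrite -{1}(wK x) -{1}(wK y).
  have -> : (eval_word g (w x) * eval_word g (w y))%g
          = eval_word g (w x ++ w y) by rewrite /eval_word big_cat.
  by rewrite phiE /ev big_cat.
- move=> i; have -> : g i = eval_word g [:: (i, false)].
    by rewrite /eval_word big_cons big_nil mulg1.
  by rewrite phiE /ev big_cons big_nil mulr1.
Qed.

Section Reflections.
Variables (k : nat) (far : rel 'I_k).

Definition gram (A : pzRingType) (a : A) : 'M[A]_k :=
  \matrix_(i, j) (if i == j then 1 else if far i j then - (1 + a) else 0).

Definition refl (A : comPzRingType) (a : A) (i : 'I_k) : 'M[A]_k :=
  1%:M - 2 *: (delta_mx i (0 : 'I_1) *m row i (gram a)).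

Lemma map_gram (A B : pzRingType) (f : {rmorphism A -> B}) (a : A) :
  map_mx f (gram a) = gram (f a).
Proof.
apply/matrixP => i j; rewrite !mxE.
by case: ifP => _; [rewrite rmorph1|case: ifP => _;
  rewrite ?rmorph0// rmorphN rmorphD rmorph1].
Qed.

Lemma map_refl (A B : comPzRingType) (f : {rmorphism A -> B}) (a : A) i :
  map_mx f (refl a i) = refl (f a) i.
Proof.
by rewrite /refl map_mxB map_mx1 map_mxZ map_mxM map_delta_mx map_row map_gram
  rmorphMn rmorph1.
Qed.

Hypothesis far_sym : forall i j, far i j = far j i.

Variables (A : comPzRingType) (a : A).
Local Notation M := (gram a).
Local Notation e i := (delta_mx i (0 : 'I_1) : 'cV[A]_k).
Local Notation E i := (e i *m row i M).

Lemma gram_tr : M^T = M.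
Proof. by apply/matrixP => i j; rewrite !mxE eq_sym far_sym. Qed.

Lemma row_gram_delta i j : row i M *m e j = (M i j)%:M.
Proof.
apply/matrixP => u v; rewrite !ord1 -colE !mxE eqxx mulr1n.
by [].
Qed.

Lemma mul_refl_dyad i j :
  E i *m E j = M i j *: (e i *m row j M).
Proof.
by rewrite mulmxA -(mulmxA (e i)) row_gram_delta mul_mx_scalar -scalemxAl.
Qed.

Lemma refl_involutive i : refl a i *m refl a i = 1%:M.
Proof.
rewrite /refl mulmxBl !mulmxBr !mul1mx mulmx1 -scalemxAl -scalemxAr.
rewrite mul_refl_dyad.
rewrite [gram a i i]mxE eqxx scale1r; move: (e i *m _) => X.
by apply/matrixP => u v; rewrite !mxE; ring.
Qed.

Lemma refl_commute i j : i != j -> ~~ far i j ->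
  refl a i *m refl a j = refl a j *m refl a i.
Proof.
move=> ij fij; rewrite /refl.
have Z (u v : 'I_k) : u != v -> ~~ far u v -> E u *m E v = 0.
  by move=> uv /negbTE fuv; rewrite mul_refl_dyad mxE (negbTE uv) fuv scale0r.
rewrite !mulmxBl !mulmxBr !mul1mx !mulmx1 -!scalemxAl -!scalemxAr.
rewrite (Z _ _ ij fij) (Z j i) 1?eq_sym// 1?far_sym// !scaler0 !subr0.
by rewrite addrAC.
Qed.

Lemma refl_isometry i : (refl a i)^T *m M *m refl a i = M.
Proof.
have ME : M *m E i = (row i M)^T *m row i M.
  by rewrite mulmxA -colE tr_row gram_tr.
have EM : (E i)^T *m M = (row i M)^T *m row i M.
  transitivity (M *m E i)^T; first by rewrite [RHS]trmx_mul gram_tr.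
  by rewrite ME trmx_mul trmxK.
have EME : (E i)^T *m M *m E i = (row i M)^T *m row i M.
  rewrite EM mulmxA -(mulmxA (row i M)^T) row_gram_delta mul_mx_scalar.
  by rewrite !mxE eqxx scale1r.
have -> : (refl a i)^T = 1%:M - 2 *: (E i)^T.
  by apply/matrixP => u v; rewrite !mxE eq_sym; congr (_ - _ * _);
    apply: eq_bigr => j _; rewrite !mxE.
rewrite /refl mulmxBl mul1mx mulmxBr mulmx1.
rewrite -!scalemxAl -!scalemxAr mulmxBl -scalemxAl ME EME EM.
move: (_^T *m _) => X.
by apply/matrixP => u v; rewrite !mxE; ring.
Qed.

End Reflections.

(** * The orbit of a chamber point *)

Section NonnegativeCoefficients.
Variable R : numDomainType.
Implicit Types p q : {poly R}.

Definition nncoef p := forall n, 0 <= p`_n.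

Lemma nncoefD p q : nncoef p -> nncoef q -> nncoef (p + q).
Proof. by move=> hp hq n; rewrite coefD addr_ge0. Qed.

Lemma nncoefM p q : nncoef p -> nncoef q -> nncoef (p * q).
Proof. by move=> hp hq n; rewrite coefM sumr_ge0// => i _; rewrite mulr_ge0. Qed.

Lemma nncoef_sum (I : Type) (r : seq I) (P : pred I) (F : I -> {poly R}) :
  (forall i, P i -> nncoef (F i)) -> nncoef (\sum_(i <- r | P i) F i).
Proof. by move=> hF n; rewrite coef_sum sumr_ge0// => i /hF. Qed.

Lemma nncoef_nat n : nncoef n%:R.
Proof. by move=> i; rewrite -polyC_natr coefC; case: ifP => _ //; exact: ler0n. Qed.

Lemma nncoef1 : nncoef 1. Proof. exact: (nncoef_nat 1). Qed.

Lemma nncoef0 : nncoef 0. Proof. by move=> n; rewrite coef0. Qed.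

Lemma nncoefX : nncoef 'X.
Proof. by move=> n; rewrite coefX ler0n. Qed.

Lemma nncoef_natN n : ~ nncoef (- n.+1%:R).
Proof.
move=> /(_ 0%N); rewrite coefN -polyC_natr coefC /= oppr_ge0.
by rewrite lern0.
Qed.

Lemma horner_nncoef p x : nncoef p -> 0 <= x -> 0 <= p.[x].
Proof.
by move=> hp x0; rewrite horner_coef sumr_ge0// => i _; rewrite mulr_ge0 ?exprn_ge0.
Qed.

End NonnegativeCoefficients.

#[local] Hint Resolve nncoefD nncoefM nncoef_nat nncoef1 nncoef0 nncoefX : nncoef.

Section Deviation.
Variables (R : realType) (k : nat) (far : rel 'I_k).
Hypothesis far_sym : forall i j, far i j = far j i.
Hypothesis far_irr : forall i, far i i = false.


Definition far_sum (A : nmodType) (c : 'cV[A]_k) (i : 'I_k) : A :=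
  \sum_(j | far i j) c j 0.

(** The vector x pairs to -1 with each e_i, so the reflection in e_i sends
    x + c to x + [step i c]. *)
Definition step (i : 'I_k) (c : 'cV[{poly R}]_k) : 'cV[{poly R}]_k :=
  \col_j (if j == i then 2 + 2 * (1 + 'X) * far_sum c i - c i 0 else c j 0).

(** The two sides of the wall of e_i, for a point x + c of the orbit of x: an
    ascent is strictly on the side of x, a descent on the other. The two
    thresholds are exchanged by [step i], and the orbit never enters the gap
    between them. *)
Definition ascent (c : 'cV[{poly R}]_k) i := nncoef (far_sum c i - c i 0).
Definition descent (c : 'cV[{poly R}]_k) i :=
  nncoef (c i 0 - 2 - (1 + 2 * 'X) * far_sum c i).

Definition balanced (c : 'cV[{poly R}]_k) :=
  forall i, nncoef (c i 0) /\ (ascent c i \/ descent c i).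

Lemma nncoef_far_sum c i : balanced c -> nncoef (far_sum c i).
Proof. by move=> bc; apply: nncoef_sum => j _; case: (bc j). Qed.

Lemma nncoef_far_sum_sub c i j : balanced c -> far i j ->
  nncoef (far_sum c i - c j 0).
Proof.
move=> bc fij; rewrite /far_sum (bigD1 j)//= addrAC subrr add0r.
by apply: nncoef_sum => l _; case: (bc l).
Qed.

Lemma ascent_descentF c i : balanced c -> ascent c i -> descent c i -> False.
Proof.
move=> bc a d; apply: (@nncoef_natN R 1).
have -> : - 2%:R = (far_sum c i - c i 0)
   + (c i 0 - 2 - (1 + 2 * 'X) * far_sum c i) + 2 * 'X * far_sum c i :> {poly R}.
  by ring.
by have := nncoef_far_sum i bc; auto 20 with nncoef.
Qed.

(** If i and j were far, each of c_i and c_j would exceed the other. *)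
Lemma descents_close c i j : balanced c -> descent c i -> descent c j ->
  ~~ far i j.
Proof.
move=> bc di dj; apply/negP => fij; apply: (@nncoef_natN R 3).
have -> : - 4%:R = (c i 0 - 2 - (1 + 2 * 'X) * far_sum c i)
   + (c j 0 - 2 - (1 + 2 * 'X) * far_sum c j) + (far_sum c i - c j 0)
   + (far_sum c j - c i 0) + 2 * 'X * far_sum c i + 2 * 'X * far_sum c j
   :> {poly R} by ring.
have [Ni Nj] := (nncoef_far_sum i bc, nncoef_far_sum j bc).
have fji : far j i by rewrite far_sym.
have [Sij Sji] := (nncoef_far_sum_sub bc fij, nncoef_far_sum_sub bc fji).
by auto 20 with nncoef.
Qed.

Lemma step_id c i : step i c i 0 = 2 + 2 * (1 + 'X) * far_sum c i - c i 0.
Proof. by rewrite mxE eqxx. Qed.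

Lemma step_neq c i j : j != i -> step i c j 0 = c j 0.
Proof. by move=> ji; rewrite mxE (negbTE ji). Qed.

Lemma far_sum_step c i j : ~~ far j i -> far_sum (step i c) j = far_sum c j.
Proof.
move=> fji; apply: eq_bigr => l fjl; rewrite step_neq//.
by apply: contraNneq fji => <-.
Qed.

Lemma ascent_step c i j : j != i -> ~~ far j i ->
  ascent (step i c) j = ascent c j.
Proof. by move=> ji fji; rewrite /ascent step_neq// far_sum_step. Qed.

Lemma descent_step c i j : j != i -> ~~ far j i ->
  descent (step i c) j = descent c j.
Proof. by move=> ji fji; rewrite /descent step_neq// far_sum_step. Qed.

Lemma step_commute c i j : i != j -> ~~ far i j ->
  step i (step j c) = step j (step i c).
Proof.
move=> ij fij; have ji : j != i by rewrite eq_sym.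
have fji : ~~ far j i by rewrite far_sym.
apply/matrixP => u v; rewrite ord1 {v}.
have [->|ui] := eqVneq u i.
  by rewrite step_id far_sum_step// !(step_neq _ ij) step_id.
have [->|uj] := eqVneq u j.
  by rewrite (step_neq _ ji) !step_id far_sum_step// step_neq.
by rewrite !step_neq.
Qed.

Lemma ascent0 i : ascent 0 i.
Proof.
rewrite /ascent mxE subr0; apply: nncoef_sum => j _; rewrite mxE.
exact: nncoef0.
Qed.

Lemma balanced0 : balanced 0.
Proof. by move=> i; rewrite mxE; split; [exact: nncoef0|left; exact: ascent0]. Qed.

(** The i-th coordinate jumps over the gap of the i-th wall. For j far from i,
    the enlarged c_i is a term of [far_sum c j] and dominates [far_sum c i],
    hence its term c_j, so j becomes an ascent. For the other j nothing
    changes. *)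
Lemma balanced_step c i : balanced c -> ascent c i -> balanced (step i c).
Proof.
move=> bc ai j; have [->|ji] := eqVneq j i.
  rewrite step_id; split.
    rewrite (_ : _ - _ = 2 + (1 + 2 * 'X) * far_sum c i
                         + (far_sum c i - c i 0)); last by ring.
    by have := nncoef_far_sum i bc; auto 20 with nncoef.
  right; rewrite /descent step_id far_sum_step ?far_irr//.
  by rewrite (_ : _ - _ = far_sum c i - c i 0)//; ring.
have [cj adj] := bc j; rewrite step_neq//; split=> //.
have [fji|fji] := boolP (far j i); last by rewrite ascent_step ?descent_step.
left; rewrite /ascent /far_sum (bigD1 i)//= step_id step_neq//.
rewrite (eq_bigr (fun l => c l 0)); last first.
  by move=> l /andP[_ li]; rewrite step_neq.
set r := \sum_(_ | _) _.
have nnr : nncoef r by apply: nncoef_sum => l _; case: (bc l).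
rewrite (_ : _ - _ = 2 + 2 * 'X * far_sum c i + (far_sum c i - c i 0)
                     + (far_sum c i - c j 0) + r); last by ring.
have := nncoef_far_sum_sub bc; rewrite far_sym in fji => /(_ _ _ fji).
by have := nncoef_far_sum i bc; auto 20 with nncoef.
Qed.

Variables (G : groupType) (g : 'I_k -> G).

(** [deviation n x c] says that a word of length n for x, each letter of which
    crosses its wall away from the base point, brings the base point to its
    translate by c. *)
Inductive deviation : nat -> G -> 'cV[{poly R}]_k -> Prop :=
| deviation1 : deviation 0 1%g 0
| deviationS n x c i : deviation n x c -> ascent c i ->
    deviation n.+1 (g i * x)%g (step i c).

Lemma deviation_balanced n x c : deviation n x c -> balanced c.
Proof.
elim=> {n x c} [|n x c i _]; first exact: balanced0.
exact: balanced_step.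
Qed.

Hypothesis g_involutive : forall i, (g i * g i = 1)%g.
Hypothesis g_commute : forall i j, i != j -> ~~ far i j ->
  (g i * g j = g j * g i)%g.

(** The exchange condition: a descent of x can be cancelled at the front of the
    word. The first letter s of the word is a descent too, so i and s commute,
    i is already a descent of the rest of the word, and induction applies. *)
Lemma deviation_exchange n x c i : deviation n x c -> descent c i ->
  exists n' c', [/\ n = n'.+1, deviation n' (g i * x)%g c', ascent c' i &
    c = step i c'].
Proof.
move=> dev; elim: dev i => {n x c} [|n x c s dev IH as_] i di.
  by have := ascent_descentF balanced0 (@ascent0 i) di.
have bc := deviation_balanced dev; have bm := balanced_step bc as_.
have [->|is'] := eqVneq i s.
  by exists n, c; rewrite mulgA g_involutive mul1g.
have ds : descent (step s c) s.
  have [_ []//] := bm s; rewrite /ascent /descent far_sum_step ?far_irr//.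
  rewrite step_id => H.
  by rewrite (_ : _ - _ = far_sum c s - c s 0)//; ring.
have fis := descents_close bm di ds.
have /IH [n' [c' [-> dev' ai' cE]]] : descent c i by rewrite -(descent_step c is').
exists n'.+1, (step s c'); split=> //.
- rewrite mulgA g_commute// -mulgA; apply: deviationS => //.
  by move: as_; rewrite cE ascent_step// 1?eq_sym// far_sym.
- by rewrite ascent_step.
- by rewrite cE step_commute// 1?eq_sym// far_sym.
Qed.

Lemma deviation_exists (w : seq 'I_k) :
  exists n c, deviation n (\prod_(i <- w) g i)%g c.
Proof.
elim: w => [|i w [n [c dev]]].
  by rewrite big_nil; exists 0%N, 0; exact: deviation1.
rewrite big_cons; have [_ [ai|di]] := deviation_balanced dev i.
  by exists n.+1, (step i c); exact: deviationS.
by have [n' [c' [_ dev' _ _]]] := deviation_exchange dev di; exists n', c'.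
Qed.

Lemma deviation_word n x c : deviation n x c ->
  exists w : n.-tuple 'I_k, x = (\prod_(i <- w) g i)%g.
Proof.
elim=> {n x c} [|n x c i _ [w ->] _]; first by exists [tuple]; rewrite big_nil.
by exists [tuple of i :: w]; rewrite big_cons.
Qed.

Definition height (c : 'cV[{poly R}]_k) : {poly R} := \sum_i c i 0.

Lemma nncoef_height n x c : deviation n x c -> nncoef (height c).
Proof.
by move=> /deviation_balanced bc; apply: nncoef_sum => i _; case: (bc i).
Qed.

(** Each letter adds at least 2, the constant term of [step_id]. *)
Lemma deviation_height n x c : deviation n x c ->
  nncoef (height c - (2 * n)%:R).
Proof.
elim=> {n x c} [|n x c i dev IH ai].
  by rewrite muln0 subr0; apply: nncoef_height deviation1.
have bc := deviation_balanced dev.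
have -> : height (step i c) = height c + (step i c i 0 - c i 0).
  rewrite /height (bigD1 i)//= [in RHS](bigD1 i)//=.
  rewrite (eq_bigr (fun l => c l 0)); last by move=> l li; rewrite step_neq.
  by ring.
rewrite step_id mulnS natrD.
rewrite (_ : _ - _ = (height c - (2 * n)%:R) + 2 * (far_sum c i - c i 0)
                     + 2 * 'X * far_sum c i); last by ring.
by have := nncoef_far_sum i bc; auto 20 with nncoef.
Qed.

End Deviation.

(** * Growth of the orbit *)

Lemma sqr_sum_le (R : realType) (I : finType) (P : pred I) (F : I -> R) :
  (\sum_(i | P i) F i) ^+ 2 <= #|I|%:R * \sum_(i | P i) F i ^+ 2.
Proof.
have -> : (\sum_(i | P i) F i) ^+ 2 = \sum_(i | P i) \sum_(j | P j) F i * F j.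
  by rewrite expr2 mulr_suml; apply: eq_bigr => i _; rewrite mulr_sumr.
have bound : \sum_(i | P i) \sum_(j | P j) F i * F j <=
    \sum_(i | P i) \sum_(j | P j) (2^-1 * F i ^+ 2 + 2^-1 * F j ^+ 2).
  apply: ler_sum => i _; apply: ler_sum => j _.
  by have := sqr_ge0 (F i - F j); nra.
apply: le_trans bound _.
under eq_bigr do rewrite big_split /=.
rewrite big_split /= [X in _ + X]exchange_big /= -big_split /=.
under eq_bigr do rewrite -big_split /=.
rewrite mulr_sumr; apply: ler_sum => i _.
rewrite sumr_const; have -> : 2^-1 * F i ^+ 2 + 2^-1 * F i ^+ 2 = F i ^+ 2 by lra.
rewrite -[leLHS]mulr_natl.
rewrite ler_wpM2r ?sqr_ge0// ler_nat.
exact: max_card.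
Qed.

Lemma horner_far_sum (R : comNzRingType) k (far : rel 'I_k)
    (c : 'cV[{poly R}]_k) i s :
  (far_sum far c i).[s] = far_sum far (map_mx (horner_eval s) c) i.
Proof.
by rewrite /far_sum horner_sum; apply: eq_bigr => j _; rewrite mxE.
Qed.

(** A Markov inequality for the distribution of degrees in p at s: the monomials
    of degree at most n are bounded by their value at 1 times s ^+ n, and for
    those of higher degree s times the derivative is at least n times the
    value. *)
Lemma horner_le_deriv (R : realType) (p : {poly R}) (s : R) n :
    nncoef p -> 1 <= s ->
  n%:R * p.[s] <= n%:R * s ^+ n * p.[1] + s * p^`().[s].
Proof.
move=> hp s1; have s0 : 0 <= s by apply: le_trans s1.
have -> : s * p^`().[s] = \sum_(i < size p) p`_i * (i%:R * s ^+ i).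
  have -> : s * p^`().[s] = ('X * p^`()).[s] by rewrite hornerM hornerX.
  rewrite (@horner_coef_wide _ (size p)); last first.
    have [->|p0] := eqVneq p 0; first by rewrite deriv0 mulr0 size_poly0.
    apply: leq_trans (size_polyMleq _ _) _; rewrite size_polyX /=.
    by rewrite (leq_trans _ (lt_size_deriv p0)).
  apply: eq_bigr => -[[|i] ip] _ /=; rewrite coefXM /=.
    by rewrite !mul0r mulr0.
  by rewrite coef_deriv !mulrnAl mul1r mulrnAr.
rewrite !horner_coef !mulr_sumr -big_split /=; apply: ler_sum => i _.
rewrite expr1n mulr1 mulrCA [_ * p`_i]mulrC -mulrDr ler_wpM2l ?hp//.
have [ni|ni] := leqP i n.
  rewrite -[leLHS]addr0 lerD ?mulr_ge0 ?exprn_ge0//.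
  by rewrite ler_wpM2l// ler_weXn2l.
rewrite -[leLHS]add0r lerD ?mulr_ge0 ?exprn_ge0//.
by rewrite ler_wpM2r ?exprn_ge0// ler_nat ltnW.
Qed.

Section Growth.
Variables (R : realType) (k : nat) (far : rel 'I_k).
Hypothesis far_sym : forall i j, far i j = far j i.
Hypothesis far_irr : forall i, far i i = false.
Variables (G : groupType) (g : 'I_k -> G).

(** The recursion at parameter s has a factor 2 s, that at parameter 1 a factor
    4: for s large the former outgrows the square of the latter, by
    Cauchy-Schwarz over the at most k terms of [far_sum]. The constant 4
    absorbs the additive constant 2 of the recursion. *)
Lemma deviation_growth n x (c : 'cV[{poly R}]_k) i (s : R) :
    16 * k%:R <= s -> deviation far g n x c ->
  (c i 0).[1] ^+ 2 <= 4 * (c i 0).[s].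
Proof.
move=> ks dev; elim: dev i => {n x c} [|n x c l dev IH al] i.
  by rewrite mxE !horner0 expr0n mulr0.
have [->|il] := eqVneq i l; last by rewrite step_neq.
have bc := deviation_balanced far_sym far_irr dev.
have s0 : 0 <= s by apply: le_trans ks; rewrite mulr_ge0.
have k1 : 1 <= k%:R :> R.
  by rewrite ler1n; case: (k) (l) => [[]|].
have cl1 : 0 <= (c l 0).[1] by apply: horner_nncoef => //; case: (bc l).
have N1 : 0 <= (far_sum far c l).[1].
  by apply: horner_nncoef => //; exact: nncoef_far_sum.
have up : (step far l c l 0).[1] <= 2 + 4 * (far_sum far c l).[1].
  by rewrite step_id !hornerE; lra.
have nn1 : 0 <= (step far l c l 0).[1].
  have := balanced_step far_sym far_irr bc al l => -[h _].
  by apply: horner_nncoef.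
have lo : 2 + (1 + 2 * s) * (far_sum far c l).[s] <= (step far l c l 0).[s].
  have := horner_nncoef al s0; rewrite step_id !hornerE; lra.
have key : 8 * (far_sum far c l).[1] ^+ 2 <= (1 + 2 * s) * (far_sum far c l).[s].
  have cs : (far_sum far c l).[1] ^+ 2 <= 4 * k%:R * (far_sum far c l).[s].
    rewrite !horner_far_sum /far_sum.
    apply: le_trans (sqr_sum_le _ _) _.
    rewrite card_ord [4 * _]mulrC -mulrA ler_wpM2l// mulr_sumr ler_sum// => j _.
    by rewrite !mxE; exact: IH.
  have Ns : 0 <= (far_sum far c l).[s].
    by apply: horner_nncoef => //; exact: nncoef_far_sum.
  by nra.
have sq : (step far l c l 0).[1] ^+ 2 <= (2 + 4 * (far_sum far c l).[1]) ^+ 2.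
  by rewrite ler_sqr// nnegrE ?addr_ge0// mulr_ge0.
have := sqr_ge0 (1 - 2 * (far_sum far c l).[1]).
move: sq lo key; set m1 := (step _ _ _ _ _).[_].
set ms := (step _ _ _ _ _).[_]; set y := (far_sum _ _ _).[s].
by set z := (far_sum _ _ _).[1]; nra.
Qed.

Lemma height_growth n x (c : 'cV[{poly R}]_k) (s : R) :
    16 * k%:R <= s -> deviation far g n x c ->
  (height c).[1] ^+ 2 <= 4 * k%:R * (height c).[s].
Proof.
move=> ks dev; rewrite /height !horner_sum.
apply: le_trans (sqr_sum_le _ _) _.
rewrite card_ord [4 * _]mulrC -mulrA ler_wpM2l// mulr_sumr ler_sum// => i _.
exact: (deviation_growth i ks dev).
Qed.

(** With 2 K in [horner_le_deriv], half of the height at s is controlled by its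
    value at 1, while [height_growth] makes it at least quadratic in that
    value. *)
Lemma height_bounded n x (c : 'cV[{poly R}]_k) (s : R) (K : nat) :
    (0 < k)%N -> 16 * k%:R <= s -> (0 < K)%N -> deviation far g n x c ->
    s * (height c)^`().[s] <= K%:R * (1 + (height c).[s]) ->
  n%:R <= 4 * k%:R * (2 * s ^+ (2 * K) + 1).
Proof.
move=> k0 ks K0 dev.
have s1 : 1 <= s.
  apply: le_trans ks; have : 1 <= k%:R :> R by rewrite ler1n.
  lra.
have s0 : 0 <= s by apply: le_trans s1.
have hc := nncoef_height far_sym far_irr dev.
have gr := height_growth ks dev.
have := horner_nncoef (deviation_height far_sym far_irr dev) ler01.
have := horner_le_deriv (2 * K) hc s1.
rewrite !hornerE natrM -polyC_natr hornerC natrM subr_ge0.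
have : 0 <= s ^+ (2 * K) by rewrite exprn_ge0.
move: gr; move: (height c).[s] (height c).[1] (_^`()).[s] (s ^+ _).
move=> f f1 f' S gr S0.
have kR : 1 <= k%:R :> R by rewrite ler1n.
have KR : 1 <= K%:R :> R by rewrite ler1n.
move=> mk nf1 hf'.
have fle : f <= 2 * S * f1 + 1.
  have : K%:R * f <= K%:R * (2 * S * f1 + 1) by lra.
  by rewrite ler_pM2l// ltr0n.
have n0 : 0 <= n%:R :> R by [].
have f1le : f1 <= 4 * k%:R * (2 * S + 1) .
  have [f1l|f1g] := leP f1 1; first by nra.
  have : f1 * f1 <= f1 * (4 * k%:R * (2 * S + 1)).
    rewrite -expr2; apply: le_trans gr _.
    by rewrite mulrCA ler_wpM2l//; nra.
  by rewrite ler_pM2l//; lra.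
lra.
Qed.

Lemma deviation_orbit n x (c : 'cV[{poly R}]_k) (s : R) (phi : G -> 'M[R]_k)
    (xi : 'cV[R]_k) :
    phi 1%g = 1%:M -> (forall x y, phi (x * y)%g = phi x *m phi y) ->
    (forall i, phi (g i) = refl far s i) ->
    gram far s *m xi = const_mx (-1) ->
    deviation far g n x c ->
  phi x *m xi = xi + map_mx (horner_eval s) c.
Proof.
move=> phi1 phiM phig xiE.
elim=> {n x c} [|n x c i _ IH _].
  rewrite phi1 mul1mx (_ : map_mx _ _ = 0) ?addr0//.
  by apply/matrixP => u v; rewrite !mxE /horner_eval horner0.
rewrite phiM -mulmxA IH phig /refl mulmxBl mul1mx -scalemxAl -mulmxA mulmxDr.
rewrite -[row i _ *m xi]row_mul xiE.
set v := map_mx _ c.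
have -> : row i (gram far s) *m v = (v i 0 - (1 + s) * far_sum far v i)%:M.
  apply/matrixP => a b; rewrite !ord1 !mxE eqxx mulr1n.
  rewrite (bigD1 i)//= !mxE eqxx mul1r; congr (_ + _).
  rewrite mulr_sumr -sumrN (bigID (far i)) /= [X in _ + X]big1 ?addr0.
    apply: eq_big => [j|j /andP[ji fij]].
      by case: eqVneq => // ->; rewrite far_irr.
    by rewrite !mxE eq_sym (negbTE ji) fij mulNr.
  by move=> j /andP[ji fij]; rewrite !mxE eq_sym (negbTE ji) (negbTE fij) mul0r.
apply/matrixP => a b; rewrite !ord1 !mxE big_ord1 !mxE eqxx andbT.
rewrite /horner_eval; case: eqVneq => [->|ai].
  by rewrite !hornerE horner_far_sum -/v /=; ring.
by rewrite mul0r mulr0 subr0.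
Qed.

End Growth.

(** * Diagonalising a one-parameter family of symmetric matrices *)

(** Gaussian elimination without divisions. Multiplying the lower rows by the
    pivot turns the Schur complement into al (al C - b^T b), which again is
    symmetric with image 1, so every pivot has image 1 and in particular is
    nonzero. *)
Lemma unit_congruence (A B : comNzRingType) (f : {rmorphism A -> B}) n
    (M : 'M[A]_n) :
    M^T = M -> map_mx f M = 1%:M ->
  exists (L : 'M[A]_n) (d : 'rV[A]_n),
    [/\ L *m M *m L^T = diag_mx d, forall i, f (d 0 i) = 1 &
        forall i : 'I_n, nat_of_ord i = 0%N -> d 0 i = M i i].
Proof.
elim: n M => [|n IH] M.
  by exists 1%:M, 0; split; [apply/matrixP|..] => -[].
rewrite -[n.+1]/(1 + n)%N in M *; rewrite -(submxK M).
set a := ulsubmx M; set b := ursubmx M; set C := drsubmx M.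
move=> Msym Mone.
have [aT bT CT] : [/\ a^T = a, b^T = dlsubmx M & C^T = C].
  by move: Msym; rewrite tr_block_mx => /eq_block_mx[].
move: Mone; rewrite -bT map_block_mx -[1%:M]/(scalar_mx 1) scalar_mx_block.
move=> /eq_block_mx[fa fb _ fC].
clearbody a b C.
pose al := a 0 0; have aE : a = al%:M.
  by apply/matrixP => i j; rewrite !ord1 [RHS]mxE eqxx mulr1n.

have fal : f al = 1 by have /matrixP/(_ 0 0) := fa; rewrite !mxE eqxx mulr1n.
pose C' := al *: (al *: C - b^T *m b).
have [||L [d [LE dE _]]] := IH C'.
- by rewrite /C' linearZ linearB linearZ /= trmx_mul trmxK CT.
- rewrite /C' map_mxZ map_mxB map_mxZ map_mxM fal fb fC mulmx0 subr0.
  by rewrite !scale1r.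
pose K : 'M[A]_(1 + n) := block_mx 1%:M 0 (- b^T) al%:M.
exists (block_mx 1%:M 0 0 L *m K), (row_mx a d); split.
- have KE : K *m block_mx a b b^T C *m K^T = block_mx a 0 0 C'.
    rewrite /K tr_block_mx !mulmx_block linearN /= trmxK !trmx0 !tr_scalar_mx.
    rewrite !mul1mx !mul0mx !mulmx0 !addr0 !mulmx1 !mul_scalar_mx.
    rewrite aE !mulNmx !mulmxN !mul_scalar_mx !mul_mx_scalar.
    rewrite !addNr mul0mx oppr0 add0r.
    by rewrite /C' [al *: C - _]addrC.
  rewrite trmx_mul !mulmxA -(mulmxA _ K) -(mulmxA _ (K *m _)) KE.
  rewrite tr_block_mx !mulmx_block !trmx0 trmx1 !mul0mx !mulmx0 !mul1mx !mulmx1.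
  rewrite !addr0 !add0r !mul0mx LE diag_mx_row; congr block_mx.
  by apply/matrixP => i j; rewrite !ord1 !mxE eqxx mulr1n.
- move=> i; rewrite mxE; case: splitP => j _ //.
  by rewrite ord1 -/al.
- move=> i i0; have -> : i = lshift n 0 by apply/val_inj.
  by rewrite row_mxEl block_mxEul.
Qed.

Lemma sorting_perm k (b : pred 'I_k) :
  exists s : {perm 'I_k}, forall i, b (s i) = (i < #|b|)%N.
Proof.
pose e := enum b ++ enum (predC b).
have se : size e = k by rewrite size_cat -!cardE cardC card_ord.
have ue : uniq e.
  rewrite cat_uniq !enum_uniq andbT /=; apply/hasPn => x.
  by rewrite !mem_enum.
have nthE (i j : 'I_k) : nth i e j = nth j e j.
  by apply: set_nth_default; rewrite se.
have inj : injective (fun i : 'I_k => nth i e i).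
  move=> i j /= /eqP; rewrite -(nthE i j) nth_uniq ?se// => /eqP.
  exact: val_inj.
exists (perm inj) => i; rewrite permE nth_cat -cardE; case: ltnP => ib.
  by have := mem_nth i (s := enum b); rewrite -cardE => /(_ i ib); rewrite mem_enum.
have := mem_nth i (s := enum (predC b)); rewrite -cardE => /(_ (i - #|b|)%N).
rewrite mem_enum inE => /(_ _)/negbTE; apply.
by rewrite -(ltn_add2l #|b|) subnKC// cardC card_ord.
Qed.

Lemma poly_sign_at_infinity (R : rcfType) (d : {poly R}) s : d != 0 ->
  cauchy_bound d <= s -> Num.sg d.[s] = sgp_pinfty d.
Proof.
move=> d0 ds; apply: (sgp_pinftyP (x := cauchy_bound d)).
  exact: ge_cauchy_bound.
by rewrite in_itv /= ds.
Qed.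

(** The bound p < k holds because the first pivot is a diagonal entry of M, that
    is 1, and gives a negative direction of -M. *)
Lemma eventually_orthonormal (R : rcfType) k (M : 'M[{poly R}]_k) (a : R) :
    M^T = M -> map_mx (horner_eval a) M = 1%:M ->
    (forall i, M i i = 1) -> (0 < k)%N ->
  exists (p : nat) (S : R) (s : {perm 'I_k}) (L : 'M[{poly R}]_k)
         (d : 'rV[{poly R}]_k) (eps : 'I_k -> R),
    [/\ (p < k)%N,
        forall t j, S < t -> 0 < eps j * (d 0 j).[t] &
        forall t, S < t ->
          let P := \matrix_(i, j)
            ((L (s j) i).[t] / Num.sqrt (eps (s j) * (d 0 (s j)).[t])) in
          P^T *m (- map_mx (horner_eval t) M) *m P =
          diag_mx (\row_j (if (j < p)%N then 1 else -1))].
Proof.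
move=> Msym Mone Mdiag k0.
have [L [d [LE dE d0E]]] := unit_congruence Msym Mone.
have dn0 j : d 0 j != 0.
  apply: contraTneq (oner_neq0 R) => dj0; have := dE j.
  by rewrite dj0 rmorph0 => <-; rewrite eqxx.
pose b : pred 'I_k := fun j => sgp_pinfty (d 0 j) == -1.
have [s sP] := sorting_perm b.
pose eps j := sgp_pinfty (d 0 j).
pose S := \sum_j cauchy_bound (d 0 j).
have Sge j : cauchy_bound (d 0 j) <= S.
  by rewrite /S (bigD1 j)//= lerDl sumr_ge0.
have sgd t j : S < t -> Num.sg (d 0 j).[t] = eps j.
  move=> St; apply: poly_sign_at_infinity => //.
  exact: le_trans (Sge j) (ltW St).
have dt0 t j : S < t -> (d 0 j).[t] != 0.
  by move=> St; rewrite -sgr_eq0 sgd// /eps /sgp_pinfty sgr_eq0 lead_coef_eq0.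
have pos t j : S < t -> 0 < eps j * (d 0 j).[t].
  by move=> St; rewrite -(sgd t j St) -normrEsg normr_gt0 dt0.
exists #|b|, S, s, L, d, eps; split=> //.
- rewrite -[X in (_ < X)%N]card_ord; apply: proper_card; apply/properP.
  split; first exact/fintype.subsetP.
  exists (Ordinal k0) => //; rewrite unfold_in /b /= d0E// Mdiag.
  rewrite /sgp_pinfty lead_coef1 sgr1 -subr_eq0 opprK.
  by rewrite -(natrD _ 1 1) pnatr_eq0.
- move=> t St P.
  pose Lt := map_mx (horner_eval t) L; pose Mt := map_mx (horner_eval t) M.
  have LEt : Lt *m Mt *m Lt^T = diag_mx (map_mx (horner_eval t) d).
    by rewrite map_trmx -!map_mxM LE map_diag_mx.
  apply/matrixP => u v.
  pose r j := (Num.sqrt (eps (s j) * (d 0 (s j)).[t]))^-1.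
  have -> : (P^T *m - Mt *m P) u v =
            - (r u * r v * (Lt *m Mt *m Lt^T) (s u) (s v)).
    have PE i j : P i j = r j * Lt (s j) i by rewrite !mxE mulrC.
    rewrite mulmxN mulNmx [LHS]mxE; congr (- _).
    rewrite [LHS]mxE [in RHS]mxE mulr_sumr; apply: eq_bigr => i _.
    rewrite [Lt^T _ _]mxE PE [X in X * _ = _]mxE [(Lt *m Mt) _ _]mxE.
    have -> : \sum_j P^T u j * Mt j i = r u * \sum_j Lt (s u) j * Mt j i.
      by rewrite mulr_sumr; apply: eq_bigr => j _; rewrite mxE PE mulrA.
    by ring.
  rewrite LEt !mxE (inj_eq perm_inj); case: eqVneq => [->|_]; last first.
    by rewrite !mulr0n mulr0 oppr0.
  rewrite !mulr1n /horner_eval -sP /b.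
  have rr : r v * r v = (eps (s v) * (d 0 (s v)).[t])^-1.
    by rewrite /r -invfM -expr2 sqr_sqrtr// ltW// pos.
  rewrite rr invfM -mulrA mulVf ?dt0// mulr1.
  rewrite -/(eps (s v)) -(sgd t (s v) St); have := dt0 t (s v) St.
  case: sgrP => // _ _; last by rewrite eqxx invrN1 opprK.
  by rewrite invr1 -subr_eq0 opprK -(natrD _ 1 1) pnatr_eq0.
Qed.

(** * Smooth matrix-valued functions *)

Section Elementary.
Variables (R : realType) (I : set R).

(** A class of functions closed under differentiation, large enough for the
    entries of the representations: it reduces smoothness to one derivative. *)
Inductive elementary : (R -> R) -> Prop :=
| elementary_cst c : elementary (fun=> c)
| elementary_id : elementary id
| elementaryD f g :
    elementary f -> elementary g -> elementary (fun t => f t + g t)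
| elementaryM f g :
    elementary f -> elementary g -> elementary (fun t => f t * g t)
| elementaryV f : elementary f -> (forall t, I t -> f t != 0) ->
    elementary (fun t => (f t)^-1)
| elementary_sqrt f : elementary f -> (forall t, I t -> 0 < f t) ->
    elementary (fun t => Num.sqrt (f t)).

Lemma elementaryN f : elementary f -> elementary (fun t => - f t).
Proof.
move=> ef; rewrite (_ : (fun _ => _) = (fun t => -1 * f t)).
  by apply: elementaryM => //; exact: elementary_cst.
by apply/funext => t; rewrite mulN1r.
Qed.

Lemma elementary_sum (J : Type) (r : seq J) (P : pred J) (f : J -> R -> R) :
  (forall j, elementary (f j)) -> elementary (fun t => \sum_(j <- r | P j) f j t).
Proof.
move=> ef; elim: r => [|j r IH].
  by under eq_fun do rewrite big_nil; exact: elementary_cst.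
under eq_fun do rewrite big_cons; case: (P j) => //.
exact: elementaryD.
Qed.

Lemma elementary_horner (p : {poly R}) : elementary (horner p).
Proof.
elim/poly_ind: p => [|p c IH].
  by rewrite (_ : horner 0 = (fun=> 0)); [exact: elementary_cst|
    apply/funext => t; rewrite horner0].
rewrite (_ : horner _ = (fun t => p.[t] * t + c)); last first.
  by apply/funext => t; rewrite !hornerE.
apply: elementaryD (elementary_cst _).
exact: elementaryM elementary_id.
Qed.

Lemma elementary_derive f : elementary f ->
  exists2 f', elementary f' & forall t, I t -> is_derive t 1 f (f' t).
Proof.
elim=> {f} [c||f g _ [f' ef df] _ [g' eg dg]|f g ef [f' ef' df] eg [g' eg' dg]
  |f ef [f' ef' df] f0|f ef [f' ef' df] f0].
- by exists (fun=> 0) => [|t _]; [exact: elementary_cst|exact: is_derive_cst].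
- by exists (fun=> 1) => [|t _]; [exact: elementary_cst|exact: is_derive_id].
- exists (fun t => f' t + g' t) => [|t It]; first exact: elementaryD.
  exact: is_deriveD (df t It) (dg t It).
- exists (fun t => f t * g' t + g t * f' t) => [|t It].
    by apply: elementaryD; exact: elementaryM.
  exact: is_deriveM (df t It) (dg t It).
- exists (fun t => - ((f t)^-1 * (f t)^-1) * f' t) => [|t It].
    apply: elementaryM => //; apply: elementaryN.
    by apply: elementaryM; exact: elementaryV.
  apply: is_derive_eq; first exact: is_deriveV (f0 t It) (df t It).
  by rewrite expr2 invfM.
- exists (fun t => (2 * Num.sqrt (f t))^-1 * f' t) => [|t It].
    apply: elementaryM => //; apply: elementaryV.
      by apply: elementaryM; [exact: elementary_cst|exact: elementary_sqrt].
    by move=> t It; rewrite mulf_neq0 ?sqrtr_eq0 -?ltNge ?f0.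
  exact: is_derive1_comp (is_derive1_sqrt (f0 t It)) (df t It).
Qed.

End Elementary.

Section MatrixDerivative.
Variable R : realType.

Lemma is_derive_mx m n (M : R -> 'M[R]_(m, n)) (M' : 'M[R]_(m, n)) t :
  (forall i j, is_derive t (1 : R) (fun s => M s i j) (M' i j)) ->
  is_derive t (1 : R) M M'.
Proof.
move=> dM; have dMt : derivable M t 1.
  by apply/derivable_mxP => i j; case: (dM i j).
apply: DeriveDef => //; rewrite derive_mx//; apply/matrixP => i j.
by rewrite mxE; apply: derive_val.
Qed.

Lemma is_derive_entry m n (M : R -> 'M[R]_(m, n)) (M' : 'M[R]_(m, n)) t i j :
  is_derive t (1 : R) M M' ->
  is_derive t (1 : R) (fun s => M s i j) (M' i j).
Proof.
move=> [dM <-]; apply: DeriveDef; first by have /derivable_mxP := dM; exact.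
by rewrite derive_mx// mxE.
Qed.

Lemma is_derive_mulmx m n r (A : R -> 'M[R]_(m, n)) (B : R -> 'M[R]_(n, r))
    (A' : 'M[R]_(m, n)) (B' : 'M[R]_(n, r)) t :
  is_derive t (1 : R) A A' -> is_derive t (1 : R) B B' ->
  is_derive t (1 : R) (fun s => A s *m B s) (A' *m B t + A t *m B').
Proof.
move=> dA dB; apply: is_derive_mx => i j.
rewrite (_ : (fun _ => _) = \sum_k (fun s => A s i k * B s k j)); last first.
  by apply/funext => s; rewrite mxE fct_sumE.
apply: is_derive_eq.
  apply: is_derive_sum => k.
  apply: is_deriveM; first exact: (is_derive_entry i k dA).
  exact: (is_derive_entry k j dB).
rewrite !mxE addrC -big_split /=; apply: eq_bigr => k _.
by rewrite [X in _ = _ + X]mulrC.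
Qed.

Lemma is_derive_trmx m n (A : R -> 'M[R]_(m, n)) (A' : 'M[R]_(m, n)) t :
  is_derive t (1 : R) A A' -> is_derive t (1 : R) (fun s => (A s)^T) A'^T.
Proof.
move=> dA; apply: is_derive_mx => i j; rewrite mxE.
under eq_fun do rewrite mxE.
exact: is_derive_entry.
Qed.

Lemma elementary_mx_derive (I : set R) m n (M : R -> 'M[R]_(m, n)) :
  (forall i j, elementary I (fun t => M t i j)) ->
  exists2 M' : R -> 'M[R]_(m, n),
    (forall i j, elementary I (fun t => M' t i j)) &
    forall t, I t -> is_derive t (1 : R) M (M' t).
Proof.
move=> eM.
pose F i j := projT1 (cid2 (elementary_derive (eM i j))).
have FP i j : elementary I (F i j) /\
    forall t, I t -> is_derive t (1 : R) (fun s => M s i j) (F i j t).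
  by rewrite /F; case: cid2.
exists (fun t => \matrix_(i, j) F i j t) => [i j|t It].
  by under eq_fun do rewrite mxE; case: (FP i j).
by apply: is_derive_mx => i j; rewrite mxE; case: (FP i j) => _; apply.
Qed.

(** By induction, each iterated derivative agrees on I with a function that has
    elementary entries; I is open, so it can be differentiated again. *)
Lemma elementary_smooth (I : set R) m n (M : R -> 'M[R]_(m, n)) :
  open I -> (forall i j, elementary I (fun t => M t i j)) -> smooth_on I M.
Proof.
move=> oI eM.
suff H N : exists2 F : R -> 'M[R]_(m, n),
    (forall i j, elementary I (fun t => F t i j)) &
    forall t, I t -> derive1n N M t = F t.
  move=> N t It; have [F eF FE] := H N.
  have [F' _ dF] := elementary_mx_derive eF.
  apply: (near_eq_derivable (f := F)); last by case: (dF t It).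
  by near=> s; rewrite FE//; near: s; exact: open_nbhs_nbhs.
elim: N => [|N [F eF FE]]; first by exists M.
have [F' eF' dF] := elementary_mx_derive eF.
exists F' => // t It; rewrite derive1nS derive1E.
rewrite (near_eq_derive (g := F)); first by case: (dF t It).
by near=> s; rewrite FE//; near: s; exact: open_nbhs_nbhs.
Unshelve. all: by end_near. Qed.

Lemma mx_norm_entry m n (A : 'M[R]_(m, n)) i j : `|A i j| <= `|A|.
Proof. by rewrite [leRHS]/Num.norm /= mx_normrE (le_bigmax _ _ (i, j)). Qed.

Lemma mx_norm_le m n (A : 'M[R]_(m, n)) (x : R) : 0 <= x ->
  (forall i j, `|A i j| <= x) -> `|A| <= x.
Proof.
move=> x0 Ax; rewrite [leLHS]/Num.norm /= mx_normrE bigmax_le//.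
Qed.

Lemma mx_norm_mulmx m n r (A : 'M[R]_(m, n)) (B : 'M[R]_(n, r)) :
  `|A *m B| <= n%:R * `|A| * `|B|.
Proof.
apply: mx_norm_le => [|i j]; first by rewrite !mulr_ge0.
rewrite mxE (le_trans (ler_norm_sum _ _ _))//.
have -> : n%:R * `|A| * `|B| = \sum_(k < n) `|A| * `|B|.
  by rewrite sumr_const card_ord -mulrA mulr_natl.
by apply: ler_sum => k _; rewrite normrM ler_pM ?mx_norm_entry.
Qed.

Lemma mx_norm_trmx m n (A : 'M[R]_(m, n)) : `|A^T| = `|A|.
Proof.
have le a b (B : 'M[R]_(a, b)) : `|B^T| <= `|B|.
  by apply: mx_norm_le => // i j; rewrite mxE mx_norm_entry.
by apply/eqP; rewrite eq_le le -{1}(trmxK A) le.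
Qed.

End MatrixDerivative.

(** * Smooth paths of orthogonal representations *)

Lemma elementary_mulmx (R : realType) (I : set R) m n r
    (A : R -> 'M[R]_(m, n)) (B : R -> 'M[R]_(n, r)) :
  (forall i j, elementary I (fun t => A t i j)) ->
  (forall i j, elementary I (fun t => B t i j)) ->
  forall i j, elementary I (fun t => (A t *m B t) i j).
Proof.
move=> eA eB i j; under eq_fun do rewrite mxE.
by apply: elementary_sum => k; exact: elementaryM.
Qed.

Section OrthogonalPath.
Variables (R : realType) (p q : nat) (G : groupType).
Local Notation n := (p + q).+1.
Local Notation J := (@form_mx R p q).

Lemma form_mx_tr : J^T = J.
Proof. exact: tr_diag_mx. Qed.

Lemma form_mx_involutive : J *m J = 1%:M.
Proof.
rewrite mulmx_diag -diag_const_mx; congr diag_mx; apply/rowP => i.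
by rewrite !mxE; case: ifP => _; rewrite ?mulr1// mulrNN mulr1.
Qed.

Section Representation.
Variable rho : G -> 'M[R]_n.
Hypothesis rho_orth : orthogonal_representation rho.

Lemma orthogonalE x : (rho x)^T *m J *m rho x = J.
Proof. exact: rho_orth.1. Qed.

Lemma orthogonal_representation1 : rho 1%g = 1%:M.
Proof.
have : (J *m (rho 1%g)^T *m J) *m rho 1%g = 1%:M.
  by rewrite -!mulmxA [_^T *m _]mulmxA orthogonalE form_mx_involutive.
move=> H; rewrite -[LHS]mul1mx -H -mulmxA; congr (_ *m _).
by case: rho_orth => _ <-; rewrite mulg1.
Qed.

Lemma orthogonal_representationV x : rho x^-1%g *m rho x = 1%:M.
Proof. by case: rho_orth => _ <-; rewrite mulVg orthogonal_representation1. Qed.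

Lemma invmx_orthogonal x : invmx (rho x) = rho x^-1%g.
Proof.
have xV := orthogonal_representationV x.
have ux : rho x \in unitmx by case/mulmx1_unit: xV.
by rewrite -[RHS]mulmx1 -(mulmxV ux) mulmxA xV mul1mx.
Qed.

Lemma orthogonal_adjoint x : (rho x^-1%g)^T *m J = J *m rho x.
Proof.
by rewrite -[LHS]mulmx1 -(orthogonal_representationV x) mulmxA orthogonalE.
Qed.

End Representation.

Variables (I : set R) (rho : R -> G -> 'M[R]_n).
Hypothesis open_I : open I.
Hypothesis rho_elementary : forall x i j, elementary I (fun t => rho t x i j).
Hypothesis rho_orth : forall t, I t -> orthogonal_representation (rho t).

Lemma tangent_cocycle_derive t x rho' : I t ->
  is_derive t (1 : R) (fun s => rho s x) rho' ->
  tangent_cocycle rho t x = rho' *m rho t x^-1%g.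
Proof.
move=> It drho; rewrite /tangent_cocycle derive1E (invmx_orthogonal (rho_orth It)).
have d := is_derive_mulmx drho (is_derive_cst (rho t x^-1%g) t 1).
by rewrite (@derive_val _ _ _ _ _ _ _ d) mulmx0 addr0.
Qed.

(** The values are in the Lie algebra by differentiating the isometry condition,
    and the cocycle relation is the product rule. *)
Lemma tangent_cocycleP t : I t -> cocycle (rho t) (tangent_cocycle rho t).
Proof.
move=> It; have O := rho_orth It; have V := orthogonal_representationV O.
have VV x : rho t x *m rho t x^-1%g = 1%:M by have := V x^-1%g; rewrite invgK.
have near_I : \forall s \near t, I s by exact: open_nbhs_nbhs.
have drho x : exists rho', is_derive t (1 : R) (fun s => rho s x) rho'.
  have [F _ dF] := elementary_mx_derive (rho_elementary x).
  by exists (F t); exact: dF.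
split=> [x|x y].
- have [rho' d] := drho x; rewrite (tangent_cocycle_derive It d).
  have dJ := is_derive_mulmx
    (is_derive_mulmx (is_derive_trmx d) (is_derive_cst J t 1)) d.
  have d0 : is_derive t (1 : R) (fun=> J) 0 := is_derive_cst J t 1.
  have : is_derive t (1 : R) (fun s => (rho s x)^T *m J *m rho s x) 0.
    apply: near_eq_is_derive d0; near=> s.
    by rewrite (orthogonalE (rho_orth _))//; near: s.
  move=> /(@derive_val _ _ _ _ _ _ _) E0.
  move: (@derive_val _ _ _ _ _ _ _ dJ); rewrite E0 mulmx0 addr0 => E.
  (* Transported back by rho t x, the Lie algebra condition is the derivative of
     the isometry condition. *)
  apply: (can_inj (g := fun X => (rho t x^-1%g)^T *m X *m rho t x^-1%g)
                  (f := fun X => (rho t x)^T *m X *m rho t x)) => [X|].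
    rewrite -!mulmxA VV mulmx1 mulmxA -trmx_mul VV.
    by rewrite trmx1 mul1mx.
  rewrite mulmx0 mul0mx [RHS]E mulmxDr mulmxDl trmx_mul !mulmxA.
  rewrite -trmx_mul V trmx1 mul1mx -!mulmxA V mulmx1 !mulmxA; congr (_ + _).
- have [rx' dx] := drho x; have [ry' dy] := drho y.
  have dxy : is_derive t (1 : R) (fun s => rho s (x * y)%g)
               (rx' *m rho t y + rho t x *m ry').
    apply: near_eq_is_derive (is_derive_mulmx dx dy); near=> s.
    by case: (@rho_orth s) => [|_ ->//]; near: s.
  rewrite (tangent_cocycle_derive It dxy) (tangent_cocycle_derive It dx).
  rewrite (tangent_cocycle_derive It dy) /Ad (invmx_orthogonal O).
  rewrite invgM; case: O => _ ->; rewrite mulmxDl !mulmxA; congr (_ + _).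
  by rewrite -(mulmxA rx') VV mulmx1.
Unshelve. all: by end_near. Qed.

(** If x . v = w then u(x) = w - Ad(rho(x)) v, and the derivative of rho(x) is
    w rho(x) - rho(x) v. In the product rule, every term then contains either
    rho(x) xi or, after moving rho(x) to the left factor, rho(x^-1) xi, times
    quantities that are independent of x. *)
Lemma derive_pairing_bound (xi : R -> 'cV[R]_n) t C : I t -> 0 <= C ->
    (forall i j, elementary I (fun s => xi s i j)) ->
  exists2 A, 0 <= A & forall x v D,
    `|v| <= C -> `|affine_action (rho t) (tangent_cocycle rho t) x v| <= C ->
    is_derive t (1 : R)
      (fun s => ((xi s)^T *m J *m rho s x *m xi s) 0 0) D ->
    `|D| <= A * (`|rho t x *m xi t| + `|rho t x^-1%g *m xi t|).
Proof.
move=> It C0 exi; have O := rho_orth It.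
have [xi_' _ /(_ t It) dxi] := elementary_mx_derive exi; set xi' := xi_' t in dxi.
pose N : R := n%:R.
pose A1 := N * `|xi'^T *m J| + N * `|(xi t)^T *m J| * (N * C).
pose A2 := N * (N * `|J|) * (N * C * `|xi t|) + N * (N * `|J|) * `|xi'|.
have N0 : 0 <= N by [].
have A1_0 : 0 <= A1 by rewrite addr_ge0 ?mulr_ge0.
have A2_0 : 0 <= A2 by rewrite addr_ge0 ?mulr_ge0.
exists (A1 + A2) => [|x v D vC wC dD]; first exact: addr_ge0.
set w := affine_action _ _ _ _ in wC.
have [F _ /(_ t It) drho] := elementary_mx_derive (rho_elementary x).
set rho' := F t in drho.
have VV : rho t x *m rho t x^-1%g = 1%:M.
  by have := orthogonal_representationV O x^-1%g; rewrite invgK.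
have rho'E : rho' = w *m rho t x - rho t x *m v.
  rewrite /w /affine_action (tangent_cocycle_derive It drho) /Ad.
  rewrite (invmx_orthogonal O) mulmxDl -!mulmxA (orthogonal_representationV O).
  by rewrite !mulmx1 [X in X - _]addrC addrK.
have dJ := is_derive_mulmx (is_derive_mulmx (is_derive_mulmx
  (is_derive_trmx dxi) (is_derive_cst J t 1)) drho) dxi.
have DE := derive_val (is_derive := is_derive_entry 0 0 dJ).
rewrite (derive_val (is_derive := dD)) mulmx0 addr0 in DE.
set y := rho t x *m xi t; set z := rho t x^-1%g *m xi t.
have zE : (xi t)^T *m J *m rho t x = z^T *m J.
  by rewrite /z trmx_mul -[RHS]mulmxA (orthogonal_adjoint O) mulmxA.
have -> : D = (xi'^T *m J *m y + (xi t)^T *m J *m (w *m y)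
               - z^T *m J *m (v *m xi t) + z^T *m J *m xi') 0 0.
  rewrite DE rho'E zE; congr (fun_of_matrix _ 0 0); congr (_ + _).
  by rewrite mulmxDl mulmxBr mulmxBl !mulmxA zE addrA.
apply: (le_trans (mx_norm_entry _ 0 0)).
have zJ : `|z^T *m J| <= N * `|J| * `|z|.
  by rewrite mulrAC -[`|z|]mx_norm_trmx; exact: mx_norm_mulmx.
have vxi : `|v *m xi t| <= N * C * `|xi t|.
  apply: le_trans (mx_norm_mulmx _ _) _.
  by rewrite ler_wpM2r// ler_wpM2l.
have wy : `|w *m y| <= N * C * `|y|.
  apply: le_trans (mx_norm_mulmx _ _) _.
  by rewrite ler_wpM2r// ler_wpM2l.
have T1 := mx_norm_mulmx (xi'^T *m J) y.
have T2 : `|(xi t)^T *m J *m (w *m y)| <= N * `|(xi t)^T *m J| * (N * C * `|y|).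
  apply: le_trans (mx_norm_mulmx _ _) _.
  by rewrite ler_wpM2l// mulr_ge0.
have T3 : `|z^T *m J *m (v *m xi t)| <= N * (N * `|J| * `|z|) * (N * C * `|xi t|).
  apply: le_trans (mx_norm_mulmx _ _) _.
  by rewrite ler_pM ?mulr_ge0// ler_wpM2l.
have T4 : `|z^T *m J *m xi'| <= N * (N * `|J| * `|z|) * `|xi'|.
  apply: le_trans (mx_norm_mulmx _ _) _.
  by rewrite ler_wpM2r// ler_wpM2l.
have H : `|xi'^T *m J *m y + (xi t)^T *m J *m (w *m y)
       - z^T *m J *m (v *m xi t) + z^T *m J *m xi'| <= A1 * `|y| + A2 * `|z|.
  apply: le_trans (ler_normD _ _) _.
  apply: le_trans (lerD (ler_normB _ _) (lexx _)) _.
  apply: le_trans (lerD (lerD (ler_normD _ _) (lexx _)) (lexx _)) _.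
  apply: le_trans (lerD (lerD (lerD T1 T2) T3) T4) _.
  rewrite /A1 /A2 -/N le_eqVlt; apply/orP; left; apply/eqP; ring.
apply: le_trans H _.
have := mulr_ge0 A1_0 (normr_ge0 z); have := mulr_ge0 A2_0 (normr_ge0 y).
lra.
Qed.

End OrthogonalPath.

(** * The family of representations *)

Section CoxeterFamily.
Variables (R : realType) (p q : nat).
Local Notation n := (p + q).+1.
Local Notation J := (@form_mx R p q).
Variables (G : groupType) (g : 'I_n -> G) (far : rel 'I_n).
Hypothesis far_sym : forall i j, far i j = far j i.
Hypothesis far_irr : forall i, far i i = false.
Hypothesis g_involutive : forall i, (g i * g i = 1)%g.
Hypothesis g_commute : forall i j, i != j -> ~~ far i j ->
  (g i * g j = g j * g i)%g.
Hypothesis g_generate : forall x, exists w, x = (\prod_(i <- w) g i)%g.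

Variable phi : G -> 'M[{poly R}]_n.
Hypothesis phi1 : phi 1%g = 1%:M.
Hypothesis phiM : forall x y, phi (x * y)%g = phi x *m phi y.
Hypothesis phi_g : forall i, phi (g i) = refl far 'X i.

Variables (S : R) (P : R -> 'M[R]_n).
Local Notation I := [set t : R | S < t].
Hypothesis S_large : 16 * n%:R <= S.
Hypothesis P_elementary : forall i j, elementary I (fun t => P t i j).
Hypothesis P_orthonormal : forall t, S < t ->
  (P t)^T *m (- gram far t) *m P t = J.

Local Notation ev t := (map_mx (horner_eval t)).

(** The inverse of the frame P t, by orthonormality. *)
Definition coframe (t : R) : 'M[R]_n := J *m (P t)^T *m (- gram far t).

Definition family (t : R) (x : G) : 'M[R]_n := coframe t *m ev t (phi x) *m P t.

(** In the frame P t, the vector that pairs to -1 with each e_i for the Gram form,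
    hence to 1 for the opposite form J. *)
Definition basepoint (t : R) : 'cV[R]_n := J *m (P t)^T *m const_mx 1.

Lemma coframeK t : S < t -> coframe t *m P t = 1%:M.
Proof.
move=> St; rewrite /coframe -!mulmxA [_^T *m _]mulmxA P_orthonormal//.
exact: form_mx_involutive.
Qed.

Lemma frameK t : S < t -> P t *m coframe t = 1%:M.
Proof. by move=> /coframeK /mulmx1C. Qed.

Lemma gramE t : S < t -> (coframe t)^T *m J *m coframe t = - gram far t.
Proof.
move=> St; rewrite -(P_orthonormal St).
have := frameK St; move: (coframe t) => Q' PQ'.
rewrite !mulmxA -trmx_mul PQ' trmx1 mul1mx.
by rewrite -mulmxA PQ' mulmx1.
Qed.

Lemma ev_phi1 t : ev t (phi 1%g) = 1%:M.
Proof. by rewrite phi1 map_mx1. Qed.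

Lemma ev_phiM t x y : ev t (phi (x * y)%g) = ev t (phi x) *m ev t (phi y).
Proof. by rewrite phiM map_mxM. Qed.

Lemma ev_phi_g t i : ev t (phi (g i)) = refl far t i.
Proof. by rewrite phi_g map_refl /= /horner_eval hornerX. Qed.

Lemma ev_phi_isometry t x :
  (ev t (phi x))^T *m gram far t *m ev t (phi x) = gram far t.
Proof.
have [w ->] := g_generate x; elim: w => [|i w IH].
  by rewrite big_nil ev_phi1 trmx1 mul1mx mulmx1.
rewrite big_cons ev_phiM ev_phi_g trmx_mul.
set A := ev t _ in IH *; rewrite -[RHS]IH.
transitivity (A^T *m ((refl far t i)^T *m gram far t *m refl far t i) *m A).
  by rewrite !mulmxA.
by rewrite refl_isometry.
Qed.

Lemma family_orthogonal t : S < t -> orthogonal_representation (family t).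
Proof.
move=> St; split=> [x|x y].
  rewrite /indefinite_orthogonal /= /family.
  have := gramE St; have := ev_phi_isometry t x.
  move: (coframe t) (ev t (phi x)) => Q' A iso QE.
  transitivity ((P t)^T *m (A^T *m (Q'^T *m J *m Q') *m A) *m P t).
    by rewrite !trmx_mul !mulmxA.
  by rewrite QE mulmxN mulNmx iso P_orthonormal.
rewrite /family ev_phiM; have := frameK St; move: (coframe t) => Q' PQ'.
by rewrite !mulmxA -[in RHS](mulmxA _ (P t)) PQ' mulmx1.
Qed.

Lemma gram_elementary i j : elementary I (fun t => (- gram far t) i j).
Proof.
rewrite (_ : (fun _ => _) = (fun t => - (if i == j then 1 else
  if far i j then - (1 + t) else 0))); last by apply/funext => t; rewrite !mxE.
apply: elementaryN; case: (i == j); first exact: elementary_cst.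
case: (far i j); last exact: elementary_cst.
apply: elementaryN; apply: elementaryD; [exact: elementary_cst|exact: elementary_id].
Qed.

Lemma JP_elementary i j : elementary I (fun t => (J *m (P t)^T) i j).
Proof.
apply: elementary_mulmx => {i j} i j /=; first exact: elementary_cst.
rewrite (_ : (fun _ => _) = (fun t => P t j i)) //.
by apply/funext => t; rewrite mxE.
Qed.

Lemma family_elementary x i j : elementary I (fun t => family t x i j).
Proof.
rewrite /family; apply: elementary_mulmx => // {i j} i j.
apply: elementary_mulmx => {i j} i j /=.
  by apply: elementary_mulmx; [exact: JP_elementary|exact: gram_elementary].
rewrite (_ : (fun _ => _) = horner (phi x i j)); first exact: elementary_horner.
by apply/funext => t; rewrite mxE.
Qed.

Lemma basepoint_elementary i j : elementary I (fun t => basepoint t i j).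
Proof.
apply: elementary_mulmx => {i j} i j /=; first exact: JP_elementary.
exact: elementary_cst.
Qed.

Lemma family_orbit t m x c : S < t -> deviation far g m x c ->
  family t x *m basepoint t = basepoint t + coframe t *m ev t c.
Proof.
move=> St dev.
(* The base point in the coordinates given by the vectors e_i. *)
pose y := P t *m basepoint t.
have QJP : (- gram far t) *m (P t *m (J *m (P t)^T)) = 1%:M.
  have := frameK St; have := coframeK St; rewrite -(gramE St).
  move: (coframe t) => Q' QP' PQ'.
  have H : Q'^T *m (P t)^T = 1%:M by rewrite -trmx_mul PQ' trmx1.
  transitivity (Q'^T *m (J *m (Q' *m P t) *m J) *m (P t)^T).
    by rewrite !mulmxA.
  by rewrite QP' mulmx1 form_mx_involutive mulmx1.
have yE : gram far t *m y = const_mx (-1).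
  transitivity (- ((- gram far t *m (P t *m (J *m (P t)^T))) *m
                   (const_mx 1 : 'cV_n))).
    by rewrite !mulNmx opprK /y /basepoint !mulmxA.
  rewrite QJP mul1mx.
  by apply/matrixP => i j; rewrite !mxE.
have := deviation_orbit far_irr (ev_phi1 t) (ev_phiM t) (ev_phi_g t) yE dev.
move=> E; rewrite /family -(mulmxA _ (P t)) -/y -(mulmxA (coframe t)) E mulmxDr.
by rewrite /y [coframe t *m (P t *m _)]mulmxA coframeK// mul1mx.
Qed.

(** The base point pairs to the same value with every e_i, so its pairing with
    the displacement c only sees the sum of the coordinates of c. *)
Lemma pairing_height t m x c : S < t -> deviation far g m x c ->
  ((basepoint t)^T *m J *m family t x *m basepoint t) 0 0 =
  ((basepoint t)^T *m J *m basepoint t) 0 0 + (height c).[t].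
Proof.
move=> St dev; rewrite -mulmxA (family_orbit St dev) mulmxDr.
rewrite [LHS]mxE; congr (_ + _).
have -> : (basepoint t)^T *m J *m (coframe t *m ev t c) = const_mx 1 *m ev t c.
  have H : (basepoint t)^T *m J = (const_mx 1 : 'rV_n) *m P t.
    rewrite /basepoint !trmx_mul trmxK form_mx_tr -!mulmxA form_mx_involutive.
    by rewrite mulmx1 trmx_const.
  by rewrite mulmxA H -(mulmxA _ (P t)) frameK// mulmx1.
rewrite mxE /height horner_sum; apply: eq_bigr => i _.
by rewrite !mxE mul1r.
Qed.

Lemma S_ge1 : 1 <= S.
Proof.
apply: le_trans S_large; have : 1 <= n%:R :> R by rewrite ler1n.
lra.
Qed.

Lemma ev_deviation_le t m x c : S < t -> deviation far g m x c ->
  `|ev t c| <= (height c).[t].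
Proof.
move=> St dev; have t0 : 0 <= t.
  by rewrite ltW// (lt_trans _ St)// (lt_le_trans _ S_ge1).
have bc := deviation_balanced far_sym far_irr dev.
have c0 i : 0 <= (c i 0).[t] by apply: horner_nncoef => //; case: (bc i).
apply: mx_norm_le => [|i j].
  by rewrite horner_nncoef//; exact: nncoef_height dev.
rewrite ord1 mxE /horner_eval ger0_norm// /height horner_sum (bigD1 i)//=.
by rewrite lerDl sumr_ge0.
Qed.

Lemma height_ge t m x c : S < t -> deviation far g m x c ->
  2 * m%:R <= (height c).[t].
Proof.
move=> St dev; have t0 : 0 <= t.
  by rewrite ltW// (lt_trans _ St)// (lt_le_trans _ S_ge1).
have := horner_nncoef (deviation_height far_sym far_irr dev) t0.
by rewrite hornerD hornerN -polyC_natr hornerC natrM subr_ge0.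
Qed.

Lemma deviation_of x : exists m (c : 'cV[{poly R}]_n), deviation far g m x c.
Proof. by have [w ->] := g_generate x; exact: deviation_exists. Qed.

Lemma finite_short (B : R) :
  finite_set [set x : G | exists m (c : 'cV[{poly R}]_n),
    deviation far g m x c /\ m%:R <= B].
Proof.
apply: (@sub_finite_set _ _ (\bigcup_(m in `I_(Num.bound `|B|))
  ((fun w : m.-tuple 'I_n => (\prod_(i <- w) g i)%g) @` setT))).
  move=> x [m [c [dev mB]]]; exists m.
    rewrite /= -(ltr_nat R) (le_lt_trans mB)//.
    by rewrite (le_lt_trans (ler_norm B))// archi_boundP.
  by have [w ->] := deviation_word dev; exists w.
by apply: bigcup_finite => // m _; apply: finite_image; exact: finite_finset.
Qed.

Lemma family_injective t : S < t -> injective (family t).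
Proof.
move=> St x y xy; have O := family_orthogonal St.
have [m [c dev]] := deviation_of (x * y^-1)%g.
have : family t (x * y^-1)%g = 1%:M.
  case: (O) => _ ->; rewrite xy -(proj2 O) mulgV.
  exact: orthogonal_representation1 O.
move=> E; have := pairing_height St dev; rewrite E mulmx1.
move=> /eqP; rewrite -subr_eq0 opprD addrA subrr add0r oppr_eq0 => /eqP h0.
have := height_ge St dev; rewrite h0 => m0.
have {}m0 : m = 0%N.
  by apply/eqP; rewrite -(pnatr_eq0 R) eq_le ler0n andbT; lra.
subst m; have [w xyE] := deviation_word dev.
by apply: (mulIg y^-1%g); rewrite xyE tuple0 big_nil mulgV.
Qed.

Lemma finite_bounded t (B : R) : S < t ->
  finite_set [set x : G | `|family t x| <= B].
Proof.
move=> St; set xi := basepoint t.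
pose D := n%:R * (n%:R * `|xi^T *m J| * B) * `|xi| + `|(xi^T *m J *m xi) 0 0|.
apply: sub_finite_set (finite_short D) => x /= xB.
have [m [c dev]] := deviation_of x; exists m, c; split=> //.
have := height_ge St dev; have := pairing_height St dev; rewrite -/xi => E.
have : `|(xi^T *m J *m family t x *m xi) 0 0|
       <= n%:R * (n%:R * `|xi^T *m J| * B) * `|xi|.
  apply: (le_trans (mx_norm_entry _ 0 0)).
  apply: (le_trans (mx_norm_mulmx _ _)).
  rewrite ler_wpM2r// ler_wpM2l//.
  apply: (le_trans (mx_norm_mulmx _ _)).
  by rewrite ler_wpM2l// mulr_ge0.
have m0 : 0 <= m%:R :> R by [].
rewrite E /D => h1 h2.
have := ler_norm ((xi^T *m J *m xi) 0 0 + (height c).[t]).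
have := ler_norm (- (xi^T *m J *m xi) 0 0); rewrite normrN; lra.
Qed.

Lemma family_discrete t : S < t -> discrete_subset (range (family t)).
Proof.
move=> St _ [x _ <-]; split; first by apply/mem_set; exists x.
pose B := `|family t x| + 1.
(* Elements of the image near rho(x) are finite in number, so the other ones can
   be removed from a neighbourhood. *)
pose F := (family t @` [set y | `|family t y| <= B]) `\ family t x.
have cF : closed F.
  have /accessible_finite_set_closed : accessible_space 'M[R]_n.
    by apply: hausdorff_accessible; exact: norm_hausdorff.
  by apply; apply: finite_setD; apply: finite_image; exact: finite_bounded.
exists (ball (family t x) 1 `&` ~` F).
  apply: filterI; first exact: nbhsx_ballx.
  by apply: open_nbhs_nbhs; split; [exact: closed_openC|move=> [_]; apply].
apply/seteqP; split=> [y [[/= bz nF] [z _ zy]]|_ ->] /=; last first.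
  by split; [split; [exact: ballxx|move=> [_]; apply]|exists x].
move: bz nF; rewrite -zy => bz nF {y zy}.
apply: contrapT => zx; apply: nF; split=> //; exists z => //=.
move: bz; rewrite -ball_normE /= => bz.
rewrite /B -[family t z](subrK (family t x)) addrC.
by rewrite (le_trans (ler_normD _ _))// lerD2l -normrN opprB ltW.
Qed.

(** The height of x^-1 equals that of x, since the pairing with the base point
    is symmetric; so both terms in [derive_pairing_bound] are at most affine in
    the height of x, and [height_bounded] bounds the length of x. *)
Lemma family_proper t : S < t ->
  properly_discontinuous_on (@indefinite_orthogonal_lie R p q)
    (affine_action (family t) (tangent_cocycle family t)).
Proof.
move=> St C _ /compact_bounded [M0 [_ /(_ (`|M0| + 1))]].
have M0lt : M0 < `|M0| + 1 by rewrite (le_lt_trans (ler_norm _))// ltrDl.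
move=> /(_ M0lt) CM; set M := `|M0| + 1 in CM.
have M_ge0 : 0 <= M by rewrite addr_ge0.
have oI : open I by exact: open_gt.
have O := family_orthogonal St.
have [A A0 bound] := derive_pairing_bound family_elementary
  family_orthogonal St M_ge0 basepoint_elementary.
pose b s := ((basepoint s)^T *m J *m basepoint s) 0 0.
have [b' db] : exists b', is_derive t (1 : R) b b'.
  have eb : elementary I b.
    apply: (@elementary_mulmx _ _ _ _ _ (fun s => (basepoint s)^T *m J) basepoint).
      apply: elementary_mulmx => i j; last exact: elementary_cst.
      rewrite (_ : (fun _ => _) = (fun s => basepoint s j i)).
        exact: basepoint_elementary.
      by apply/funext => s; rewrite mxE.
    exact: basepoint_elementary.
  by have [f _ df] := elementary_derive eb; exists (f t); exact: df.
set xi := basepoint t.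
pose K0 := A * (2 * `|xi| + 2 * (n%:R * `|coframe t|)) + `|b'|.
have K0_ge0 : 0 <= K0 by rewrite addr_ge0// mulr_ge0// addr_ge0// !mulr_ge0.
have t0 : 0 <= t by rewrite ltW// (lt_trans _ St)// (lt_le_trans _ S_ge1).
pose K := (Num.bound (t * K0)).+1.
pose D := 4 * n%:R * (2 * t ^+ (2 * K) + 1) : R.
apply: sub_finite_set (finite_short D) => x /= [_ [[v Cv <-] Cw]].
have [m [c dev]] := deviation_of x; exists m, c; split=> //.
apply: (height_bounded far_sym far_irr _ _ _ dev) => //.
  by rewrite (le_trans S_large)// ltW.
set f := (height c).[t].
have f0 : 0 <= f by exact: le_trans (normr_ge0 _) (ev_deviation_le St dev).
have orbit_le z m' c' : deviation far g m' z c' -> (height c').[t] = f ->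
    `|family t z *m xi| <= `|xi| + n%:R * `|coframe t| * f.
  move=> dev' fE; rewrite (family_orbit St dev') -/xi.
  apply: (le_trans (ler_normD _ _)); rewrite lerD2l.
  apply: (le_trans (mx_norm_mulmx _ _)); rewrite ler_wpM2l ?mulr_ge0//.
  by rewrite -fE; exact: ev_deviation_le dev'.
have hx := orbit_le x m c dev erefl.
(* The height of x^-1 is f as well: transposing the pairing with the base point
   exchanges x and x^-1. *)
have [m' [c' dev']] := deviation_of x^-1%g.
have hxV : `|family t x^-1%g *m xi| <= `|xi| + n%:R * `|coframe t| * f.
  apply: (orbit_le _ _ _ dev').
  have := pairing_height St dev; have := pairing_height St dev'.
  have -> : ((basepoint t)^T *m J *m family t x^-1%g *m basepoint t) 0 0
          = ((basepoint t)^T *m J *m family t x *m basepoint t) 0 0.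
    rewrite -[in RHS](mulmxA _ J) -(orthogonal_adjoint O x).
    rewrite -[in RHS]form_mx_tr.
    move: (basepoint t) (family t _) => a F.
    have -> : a^T *m (F^T *m J^T) *m a = (a^T *m J *m F *m a)^T.
      by rewrite !trmx_mul trmxK !mulmxA.
    by rewrite [RHS]mxE.
  by move=> ->; rewrite -/f => /addrI.
have dh : is_derive t (1 : R)
    (fun s => ((basepoint s)^T *m J *m family s x *m basepoint s) 0 0)
    (b' + (height c)^`().[t]).
  have dpb : is_derive t (1 : R) (b + horner (height c)) (b' + (height c)^`().[t]).
    exact: is_deriveD.
  apply: near_eq_is_derive dpb; near=> s.
  rewrite [RHS](pairing_height _ dev)//; near: s; exact: open_nbhs_nbhs.
have := bound x v _ (CM _ Cv) (CM _ Cw) dh; rewrite -/xi => le1.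
have le2 : `|b' + (height c)^`().[t]|
           <= A * (2 * `|xi| + 2 * (n%:R * `|coframe t|) * f).
  by apply: le_trans le1 _; rewrite ler_wpM2l//; lra.
have le3 : (height c)^`().[t] <= K0 * (1 + f).
  have h1 := ler_norm (b' + (height c)^`().[t]).
  have h2 := ler_norm (- b'); rewrite normrN in h2.
  have h3 : 0 <= A * `|xi| * f by rewrite !mulr_ge0.
  have h4 : 0 <= A * (n%:R * `|coframe t|) by rewrite !mulr_ge0.
  have h5 : 0 <= `|b'| * f by rewrite mulr_ge0.
  rewrite /K0; lra.
apply: le_trans (ler_wpM2l t0 le3) _.
rewrite mulrA ler_wpM2r ?addr_ge0//.
by rewrite (le_trans (ltW (archi_boundP _)))// ?mulr_ge0// ler_nat.
Unshelve. all: by end_near. Qed.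

End CoxeterFamily.

(** * Existence of proper affine actions *)

Lemma right_angled_coxeter_refl k (G : groupType) (g : 'I_k -> G) :
    right_angled_coxeter g ->
  exists far : rel 'I_k,
    [/\ forall i j, far i j = far j i,
        forall i, far i i = false,
        forall i, (g i * g i = 1)%g,
        forall i j, i != j -> ~~ far i j -> (g i * g j = g j * g i)%g &
        forall x, exists w, x = (\prod_(i <- w) g i)%g] /\
    forall (A : comPzRingType) (a : A), exists phi : G -> 'M[A]_k,
      [/\ phi 1%g = 1%:M, forall x y, phi (x * y)%g = phi x *m phi y &
          forall i, phi (g i) = refl far a i].
Proof.
move=> [m [[m1 m_sym m2] pres]]; have [surj eqv] := pres.
pose far : rel 'I_k := fun i j => m i j == None.
have far_sym i j : far i j = far j i by rewrite /far m_sym.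
have near_two i j : i != j -> ~~ far i j -> m i j = Some 2%N.
  by rewrite /far => /m2[->//|->].
have g_involutive i : (g i * g i = 1)%g.
  have /eqv : word_equiv (coxeter_relators m) [:: (i, false); (i, false)] [::].
    apply: (@word_equiv_rel _ _ [::] [::] [:: (i, false); (i, false)]).
    by exists i, i, 1%N; rewrite m1.
  by rewrite /eval_word !big_cons !big_nil /= mulg1.
exists far; split; first split=> //.
- by move=> i; rewrite /far m1.
- move=> i j ij fij.
  pose w := [:: (i, false); (j, false); (i, false); (j, false)].
  have /eqv : word_equiv (coxeter_relators m) w [::].
    apply: (@word_equiv_rel _ _ [::] [::] w).
    by exists i, j, 2%N; rewrite near_two.
  rewrite /eval_word !big_cons !big_nil /= mulg1 => E.
  apply: (mulIg (g i * g j)%g); rewrite -!mulgA E.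
  by rewrite [(g i * (g i * _))%g]mulgA g_involutive mul1g g_involutive.
- move=> x; have [w <-] := surj x; exists (map fst w).
  rewrite big_map; apply: eq_bigr => -[i []] _ //=.
  by apply: (mulIg (g i)); rewrite mulVg g_involutive.
- move=> A a; apply: (presentation_lift pres) => [i|r].
    exact: refl_involutive.
  move=> [i [j [n [mij ->]]]]; have [ij|ij] := eqVneq i j.
    move: mij; rewrite ij m1 => -[<-].
    by rewrite /= !big_cons big_nil /= mulr1; exact: refl_involutive.
  have fij : ~~ far i j by rewrite /far mij.
  move: mij; rewrite (near_two _ _ ij fij) => -[<-].
  rewrite /= !big_cons big_nil /= mulr1.
  have C : refl far a i * refl far a j = refl far a j * refl far a i.
    exact: refl_commute.
  have sq l : refl far a l * refl far a l = 1 by exact: refl_involutive.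
  by rewrite [X in _ * (_ * X)]C [_ * (_ * refl far a i)]mulrA sq mul1r sq.
Qed.

(** At parameter -1 the far pairs become orthogonal and the Gram matrix is the
    identity. *)
Lemma eventually_orthonormal_gram (R : realType) k (far : rel 'I_k) :
    (forall i j, far i j = far j i) -> (0 < k)%N ->
  exists (p q : nat) (S : R) (P : R -> 'M[R]_k),
    [/\ (p + q).+1 = k, 16 * k%:R <= S,
        forall i j, elementary [set t | S < t] (fun t => P t i j) &
        forall t, S < t -> (P t)^T *m (- gram far t) *m P t =
          diag_mx (\row_(j < k) (if (j < p)%N then 1 else -1))].
Proof.
move=> far_sym k0.
have evE t : map_mx (horner_eval t) (gram far 'X) = gram far t :> 'M[R]_k.
  by rewrite map_gram /= /horner_eval hornerX.
have [||i||p [S [s [L [d [eps [pk pos PE]]]]]]] :=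
    @eventually_orthonormal R k (gram far 'X) (-1) => //.
- exact: gram_tr.
- rewrite evE; apply/matrixP => i j; rewrite !mxE subrr oppr0.
  by case: eqP => // _; case: (far i j).
- by rewrite mxE eqxx.
exists p, (k - p).-1, (Num.max S (16 * k%:R)), (fun t => \matrix_(i, j)
  ((L (s j) i).[t] / Num.sqrt (eps (s j) * (d 0 (s j)).[t]))); split.
- by rewrite -addnS prednK ?subn_gt0// subnKC// ltnW.
- by rewrite le_max lexx orbT.
- move=> i j; rewrite (_ : (fun _ => _) = (fun t => (L (s j) i).[t] *
    (Num.sqrt (eps (s j) * (d 0 (s j)).[t]))^-1)); last first.
    by apply/funext => t; rewrite mxE.
  have pos' t : Num.max S (16 * k%:R) < t -> 0 < eps (s j) * (d 0 (s j)).[t].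
    by rewrite gt_max => /andP[St _]; exact: pos.
  apply: elementaryM; first exact: elementary_horner.
  apply: elementaryV => [|t St]; last by rewrite sqrtr_eq0 -ltNge pos'.
  apply: elementary_sqrt => //.
  by apply: elementaryM; [exact: elementary_cst|exact: elementary_horner].
- by move=> t; rewrite gt_max => /andP[St _]; rewrite -evE; exact: PE.
Qed.

Theorem theorem1p5 (R : realType) (k : nat) (k_gt0 : (0 < k)%N)
    (Gam : groupType) (g : 'I_k -> Gam)
    (Gam_coxeter : right_angled_coxeter g)
    (Gam_irreducible : coxeter_irreducible (range g)) :
  exists p q : nat, (p + q + 1)%N = k /\
  exists (I : set R) (rho : R -> Gam -> 'M[R]_((p + q).+1)),
    [/\ [/\ open I, is_interval I & I !=set0],
        forall t, I t ->
          [/\ orthogonal_representation (rho t), injective (rho t) &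
              discrete_subset (range (rho t))],
        forall x, smooth_on I (fun t => rho t x) &
        forall t, I t ->
          cocycle (rho t) (tangent_cocycle rho t) /\
          properly_discontinuous_on
            (@indefinite_orthogonal_lie R p q)
            (affine_action (rho t) (tangent_cocycle rho t))].
Proof.
have [far [[far_sym far_irr gg gC gen] lift]] :=
  right_angled_coxeter_refl Gam_coxeter.
have [phi [phi1 phiM phi_g]] := lift {poly R} 'X.
have [p [q [S [P [kE Sk eP PE]]]]] := eventually_orthonormal_gram R far_sym k_gt0.
subst k; exists p, q; split; first by rewrite addn1.
have oI : open [set t | S < t] by exact: open_gt.
have O t := family_orthogonal far_sym gen phi1 phiM phi_g PE (t := t).
have eF := family_elementary far phi eP.
exists [set t | S < t], (family far phi P); split.
- split=> //; last by exists (S + 1); rewrite /= ltrDl.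
  by move=> x y /= Sx _ z /andP[xz _]; exact: lt_le_trans xz.
- move=> t St; split; first exact: O.
    exact: (family_injective far_sym far_irr gg gC gen phi1 phiM phi_g Sk PE).
  exact: (family_discrete far_sym far_irr gg gC gen phi1 phiM phi_g Sk PE).
- by move=> x; apply: elementary_smooth => //; exact: eF.
- move=> t St; split; first exact: (tangent_cocycleP oI eF O).
  exact: (family_proper far_sym far_irr gg gC gen phi1 phiM phi_g Sk eP PE).
Qed.
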